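(* Let $q$ be a prime power and $n\ge1$. Fix $[A]\in\mathrm{PGL}(2,q)$ of order $d$ and set $d_0=\gcd(d,n)$. Then for any positive integer $s$ with $\gcd(s,n)=1$ and any monic irreducible $f\in\mathbb F_{q^n}[x]$ of degree $\frac{d}{d_0}s>2$, the following are equivalent: (i) $f$ is $[A,\sigma_i]$-invariant for some $1\le i\le n$ with $\gcd(i,n)=1$; (ii) $f$ is $[A,\sigma_i]$-invariant for some $1\le i\le n$ with $\gcd(i,n)=1$, and the least positive integer $t$ such that $f\in\mathbb F_{q^t}[x]$ is $t=d_0$; (iii) $f$ divides a monic irreducible polynomial $G\in\mathbb F_q[x]$ of degree $ds$ that is $[A]$-invariant, i.e. $[A]\circ G=G$.
   Context: $\sigma_i$ denotes the $i$-th power of the Frobenius automorphism $\alpha\mapsto\alpha^q$ of $\mathbb F_{q^n}$, extended coefficientwise to $\mathbb F_{q^n}[x]$. For $A=\begin{pmatrix}a&b\\ c&d\end{pmatrix}\in\mathrm{GL}(2,q)$ and a polynomial $h$ of degree $m$, $[A]\circ h$ is the unique monic scalar multiple of $(cx+d)^m h\!\left(\frac{ax+b}{cx+d}\right)$. Viewing $[A]\in\mathrm{PGL}(2,q)\subseteq\mathrm{PGL}(2,q^n)$, $[A,\sigma_i]\ast f:=[A]\circ(\sigma_i(f))$, and $f$ is $[A,\sigma_i]$-invariant if $[A,\sigma_i]\ast f=f$. *)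

(* Defs.v *)
From HB Require Import structures.
From mathcomp Require Import all_boot all_order all_algebra all_fingroup all_solvable all_field.

Set Implicit Arguments.
Unset Strict Implicit.
Unset Printing Implicit Defensive.

Import GRing.Theory.
Local Open Scope ring_scope.

Section Moebius.
Variable K : fieldType.
Implicit Types (M : 'M[K]_2) (h : {poly K}).

(* For M = (a b; c d) and h of degree m, the polynomial                       *)
(* (cX + d)^m h((aX + b) / (cX + d)); see moebius_numE.                       *)
Definition moebius_num M h : {poly K} :=
  \sum_(k < size h)
    h`_k *: ((M 0 0 *: 'X + (M 0 1)%:P) ^+ k
             * (M 1 0 *: 'X + (M 1 1)%:P) ^+ ((size h).-1 - k)).

(* [M] o h, normalised to be monic; it depends on M only up to a nonzero      *)
(* scalar (moebiusZ), i.e. only on the class of M in PGL(2, K).               *)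
Definition moebius M h : {poly K} :=
  (lead_coef (moebius_num M h))^-1 *: moebius_num M h.

Lemma moebius_numE M h :
  M 1 0 *: 'X + (M 1 1)%:P != 0 ->
  let num := tofrac (M 0 0 *: 'X + (M 0 1)%:P) in
  let den := tofrac (M 1 0 *: 'X + (M 1 1)%:P) in
  tofrac (moebius_num M h)
    = den ^+ (size h).-1 * (map_poly (@tofrac _ \o polyC) h).[num / den].
Proof.
move=> den0 num den; have den0' : den != 0 by rewrite tofrac_eq0.
have inj0 : (@tofrac _ \o polyC) (0 : K) = 0 by rewrite /= polyC0 tofrac0.
rewrite (@horner_coef_wide _ (size h)); last first.
  exact: size_poly.
rewrite /moebius_num raddf_sum mulr_sumr; apply: eq_bigr => k _.
rewrite coef_map_id0 // -[h`_k *: _]mul_polyC /= !tofracM !tofracXn -/num -/den.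
have le_k : (k <= (size h).-1)%N by rewrite -ltnS (leq_trans (ltn_ord k)) ?leqSpred.
rewrite [RHS]mulrCA; congr (_ * _).
rewrite expr_div_n [RHS]mulrCA; congr (_ * _).
by rewrite -{2}(subnK le_k) exprD mulfK ?expf_neq0.
Qed.

Lemma moebiusZ (u : K) M h : u != 0 -> moebius (u *: M) h = moebius M h.
Proof.
move=> u0; have num_scale : moebius_num (u *: M) h
    = u ^+ (size h).-1 *: moebius_num M h.
  rewrite /moebius_num scaler_sumr; apply: eq_bigr => k _; rewrite !mxE.
  have le_k : (k <= (size h).-1)%N.
    by rewrite -ltnS (leq_trans (ltn_ord k)) ?leqSpred.
  have lin_scale a b : (u * a) *: 'X + (u * b)%:P = u *: (a *: 'X + b%:P).
    by rewrite scalerDr scalerA -[u *: b%:P]mul_polyC -polyCM.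
  rewrite !lin_scale !exprZn -scalerAl -scalerAr !scalerA; congr (_ *: _).
  by rewrite -mulrA -exprD subnKC // mulrC.
rewrite /moebius num_scale lead_coefZ invfM scalerA; congr (_ *: _).
by rewrite mulrAC mulVf ?mul1r // expf_neq0.
Qed.

End Moebius.

Section Semilinear.
Variables (F : finFieldType) (L : fieldExtType F).
Implicit Types (f : {poly L}) (A : {'GL_2[F]}).

(* Powers of the Frobenius map over the ground field F, which has q = #|F|    *)
(* elements.                                                                  *)
Definition frob_poly (i : nat) f : {poly L} :=
  map_poly (iter i (fun a : L => a ^+ #|F|)) f.

Definition semi_act A (i : nat) f : {poly L} :=
  moebius (map_mx (in_alg L) (GLval A)) (frob_poly i f).

Definition semi_invariant A (i : nat) f : Prop := semi_act A i f = f.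

(* f has its coefficients in the subfield of L with #|F| ^ t elements.        *)
Definition defined_over (t : nat) f : Prop :=
  exists2 K : {subfield L}, \dim K = t & f \is a polyOver K.

Definition least_defined_over (t : nat) f : Prop :=
  [/\ (0 < t)%N, defined_over t f
    & forall u : nat, (0 < u)%N -> defined_over u f -> (t <= u)%N].

End Semilinear.

(* The class of A in PGL(2, F), the quotient of GL(2, F) by its centre (the   *)
(* scalar matrices).                                                          *)
Definition pgl_class (F : finFieldType) (A : {'GL_2[F]}) :=
  coset 'Z('GL_2[F])%g A.

(* Main.v *)
Require Import Defs.
From HB Require Import structures.
From mathcomp Require Import all_boot all_order all_algebra all_fingroup all_solvable all_field.
From mathcomp Require Import ring.

Set Implicit Arguments.
Unset Strict Implicit.
Unset Printing Implicit Defensive.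

Import GRing.Theory.
Local Open Scope ring_scope.

(* Let x be a root of f, let phi be the q-Frobenius and let D be the period   *)
(* of x under phi, i.e. the degree of x over F_q; the degree of x over        *)
(* F_{q^n} is then D / gcd(D, n).  The conjugates of x over F_{q^n} are the   *)
(* phi^(nk) x, so f is [A, sigma_i]-invariant iff A x = phi^j x for some      *)
(* j = i mod n.  As A commutes with phi this gives A^k x = phi^(jk) x; since  *)
(* deg f > 2, only scalar matrices fix x, hence A^k x = x iff d | k, and      *)
(* d = D / gcd(D, j).  When gcd(j, n) = 1, comparing with the degree of f     *)
(* yields gcd(D, n) = gcd(d, n) and D = d s: the minimal polynomial of x over *)
(* F_q is the required G, and phi^u fixes f iff gcd(d, n) | u.  Conversely,   *)
(* given G, A x = phi^k x for some k, where gcd(D, k) = s, and k can be       *)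
(* changed modulo D = d s into an exponent coprime to n.                      *)

(** * Periods and orbits *)

(** Everything is read off one root x of f, taken in an extension supplied by [root_extension].
    There invariance becomes an equation between A x and a Frobenius conjugate of x
    ([semi_invariantP]), and the order of [A] becomes a quotient of the period of x ([order_frob]).
    The rest is arithmetic of exponents: [period_eq_order_mul] leads from (i) to (ii) and (iii),
    with [least_defined_gcd] giving the field of definition and [orbit_poly_irreducible] giving G,
    and [coprime_frob_exponent] leads from (iii) back to (i). *)

(** Cancel gcd(D, n): the cofactors of D and n are coprime. This computes the period of the n-th
    power of a map for which a point has period D. *)
Lemma dvdn_mul_gcd (D n k : nat) : (0 < D)%N ->
  (D %| n * k)%N = (D %/ gcdn D n %| k)%N.
Proof.
move=> D0; set g := gcdn D n.
have g0 : (0 < g)%N by rewrite gcdn_gt0 D0.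
have eD : (D %/ g * g)%N = D := divnK (dvdn_gcdl D n).
have en : (n %/ g * g)%N = n := divnK (dvdn_gcdr D n).
have -> : (n * k = n %/ g * k * g)%N by rewrite mulnAC en.
rewrite -{1}eD dvdn_pmul2r // Gauss_dvdr //.
by rewrite /coprime -(eqn_pmul2r g0) muln_gcdl eD en mul1n.
Qed.

Lemma coprime_shift (a d n : nat) : (0 < d)%N -> (0 < n)%N -> coprime a d ->
  exists k, coprime (a + d * k) n.
Proof.
move=> d0 n0 a_d; wlog a0 : a a_d / (0 < a)%N.
  (* The case a = 0 is moved to a + d, because [primes 0] is empty and would make the choice of k
     below fail. *)
  move=> IH; have [|//|k co] := IH (a + d)%N; rewrite ?addn_gt0 ?d0 ?orbT //.
    by rewrite /coprime gcdnC gcdnDr gcdnC.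
  by exists k.+1; rewrite mulnS addnA.
(* k is the part of n prime to a, so each prime factor of n divides exactly one of a and k. *)
exists (n`_(\pi(a)^'))%N; set k := (n`_ _)%N; have k0 : (0 < k)%N by apply: part_gt0.
rewrite coprime_has_primes ?addn_gt0 ?a0 //; apply/hasPn => p.
rewrite !mem_primes n0 => /andP[p_pr p_n]; rewrite p_pr addn_gt0 a0 /=.
have pk : (p %| k)%N = ~~ (p %| a)%N.
  have := primes_part \pi(a)^' n => /(congr1 (fun s => p \in s)).
  by rewrite mem_primes mem_filter !mem_primes p_pr k0 n0 p_n /= andbT !inE mem_primes p_pr a0.
have [pa|pa] := boolP (p %| a)%N; last first.
  by rewrite dvdn_addl // dvdn_mull // pk pa.
rewrite dvdn_addr // Euclid_dvdM // pk pa orbF; apply/negP => pd.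
by move: (dvdn_gcd p a d); rewrite pa pd (eqP a_d) dvdn1; case: eqP p_pr => // ->.
Qed.

Section Period.
Variables (T : eqType) (f : T -> T) (x : T).
Hypothesis f_inj : injective f.

Lemma iter_inj k : injective (iter k f).
Proof. by elim: k => [|k IH] u v //= /f_inj /IH. Qed.

Lemma iter_mul_fix N c : iter N f x = x -> iter (N * c) f x = x.
Proof. by move=> e; elim: c => [|c IH]; rewrite ?muln0 // mulnS iterD IH. Qed.

Lemma period_exists N : (0 < N)%N -> iter N f x = x ->
  exists2 D, (0 < D)%N & forall k, (iter k f x == x) = (D %| k)%N.
Proof.
move=> N0 eN; have ex : exists D, (0 < D)%N && (iter D f x == x).
  by exists N; rewrite N0 eN eqxx.
case: (ex_minnP ex) => D /andP[D0 /eqP eD] minD; exists D => // k.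
apply/eqP/idP => [ek|/dvdnP[c ->]]; last by rewrite mulnC iter_mul_fix.
rewrite /dvdn -leqn0 leqNgt; apply/negP => r0.
suff /minD : (0 < k %% D)%N && (iter (k %% D) f x == x) by rewrite leqNgt ltn_mod D0.
by rewrite r0 /= -{2}ek {2}(divn_eq k D) addnC iterD mulnC iter_mul_fix.
Qed.

Variable D : nat.
Hypothesis D_gt0 : (0 < D)%N.
Hypothesis periodP : forall k, (iter k f x == x) = (D %| k)%N.

Lemma iter_period_eq i j : (i <= j)%N ->
  (iter i f x == iter j f x) = (D %| j - i)%N.
Proof.
move=> le_ij; rewrite -{1}(subnKC le_ij) iterD.
by rewrite (inj_eq (@iter_inj i)) eq_sym periodP.
Qed.

Lemma iter_period_mod i j :
  (iter i f x == iter j f x) = (i == j %[mod D])%N.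
Proof.
wlog le_ij : i j / (i <= j)%N.
  move=> IH; case: (leqP i j) => [/IH //|/ltnW/IH].
  by rewrite eq_sym => ->; rewrite eq_sym.
by rewrite iter_period_eq // eq_sym eqn_mod_dvd.
Qed.

Lemma mem_traject_period k : iter k f x \in traject f x D.
Proof.
apply/trajectP; exists (k %% D)%N; first by rewrite ltn_mod.
rewrite {1}(divn_eq k D) addnC iterD mulnC iter_mul_fix //.
by apply/eqP; rewrite periodP.
Qed.

Lemma traject_period_uniq : uniq (traject f x D).
Proof.
case: D D_gt0 periodP => // n _ per; rewrite looping_uniq.
apply/trajectP => -[i lt_in] /eqP; rewrite eq_sym.
rewrite -{1}(subnKC (ltnW lt_in)) iterD (inj_eq (@iter_inj i)) eq_sym per => /dvdn_leq.
by rewrite subn_gt0 lt_in => /(_ isT); rewrite leqNgt ltnS leq_subr.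
Qed.

Lemma perm_traject_period : perm_eq (traject f (f x) D) (traject f x D).
Proof.
have /eqP per := periodP D; rewrite dvdnn in per.
case: D D_gt0 per => // n _ per.
by rewrite trajectSr -iterSr per perm_rcons.
Qed.

End Period.

(** * Fixed fields, and minimal polynomials as products over orbits *)

Section Descent.
Variables (K E : fieldType) (iota : {rmorphism K -> E}).

(** Otherwise g and p would be coprime, hence coprime over E too, and could not share a root. This
    makes one common root enough to prove divisibility. *)
Lemma irredp_dvd_root (g p : {poly K}) (x : E) : irreducible_poly g ->
  root (map_poly iota g) x -> root (map_poly iota p) x -> g %| p.
Proof.
move=> g_irr gx px; apply: contraTT px; rewrite -irreducible_poly_coprime //.
by rewrite -(coprimep_map iota) => co; exact: (coprimep_root co gx).
Qed.

Lemma irredp_monic_root (g p : {poly K}) (x : E) :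
    irreducible_poly g -> irreducible_poly p -> g \is monic -> p \is monic ->
  root (map_poly iota g) x -> root (map_poly iota p) x -> g = p.
Proof.
move=> gi pi gm pm gx px; apply/eqP; rewrite -eqp_monic //.
by rewrite /eqp (irredp_dvd_root gi gx px) (irredp_dvd_root pi px gx).
Qed.

(** The image of K is the fixed field of sigma. Two instances are used: K = F with the q-Frobenius,
    and K = L with its n-th power. *)
Variable sigma : {rmorphism E -> E}.
Hypothesis fixE : forall x, sigma x = x <-> exists y, x = iota y.

Lemma poly_descent (p : {poly E}) : map_poly sigma p = p ->
  exists r, p = map_poly iota r.
Proof.
move=> sp; have ex i : exists y, iota y == p`_i.
  have /fixE[y ->] : sigma p`_i = p`_i by rewrite -coef_map sp.
  by exists y.
exists (\poly_(i < size p) xchoose (ex i)); apply/polyP => i.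
rewrite coef_map coef_poly /=; case: ltnP => [_|le]; last by rewrite nth_default ?(rmorph0 iota).
by apply/esym/eqP; exact: (xchooseP (ex i)).
Qed.

Lemma map_descent (r : {poly K}) : map_poly sigma (map_poly iota r) = map_poly iota r.
Proof.
rewrite -map_poly_comp; apply: eq_map_poly => y /=.
by apply/fixE; exists y.
Qed.

Lemma root_sigma (r : {poly K}) k x : root (map_poly iota r) x ->
  root (map_poly iota r) (iter k sigma x).
Proof.
by elim: k => //= k IH /IH; rewrite -{2}map_descent mapf_root.
Qed.

Variables (x : E) (D : nat).
Hypothesis D_gt0 : (0 < D)%N.
Hypothesis periodP : forall k, (iter k sigma x == x) = (D %| k)%N.

Let orbit := traject sigma x D.

(** As sigma permutes the orbit, it fixes the coefficients of the product, which therefore descend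
    to K. A nonconstant divisor over K vanishes at some point of the orbit, and its root set is
    stable under sigma, so it vanishes on the whole orbit. *)
Lemma orbit_poly_irreducible : exists P : {poly K},
  [/\ P \is monic, irreducible_poly P & map_poly iota P = \prod_(z <- orbit) ('X - z%:P)].
Proof.
have s_inj : injective sigma := @fmorph_inj _ _ sigma.
have [|P eP] := @poly_descent (\prod_(z <- orbit) ('X - z%:P)).
  rewrite rmorph_prod -[RHS](perm_big _ (perm_traject_period D_gt0 periodP)) /=.
  have -> : traject sigma (sigma x) D = map sigma orbit.
    rewrite /orbit; elim: D (x) => //= n IH y; by rewrite IH.
  by rewrite big_map; apply: eq_bigr => z _; rewrite rmorphB /= map_polyX map_polyC.
have sP : size P = D.+1.
  by rewrite -(size_map_poly iota) -eP size_prod_XsubC size_traject.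
exists P; split=> //.
  by rewrite -(map_monic iota) -eP monic_prod_XsubC.
split=> [|g g_neq1 g_P]; first by rewrite sP ltnS.
rewrite /eqp g_P /= -(dvdp_map iota) -eP; move: g_P.
rewrite -(dvdp_map iota) -eP => /dvdp_prod_XsubC[m gm].
case em: (mask m orbit) gm => [|z s] gm.
  by move: (eqp_size gm); rewrite big_nil size_map_poly size_poly1 => /eqP; rewrite (negPf g_neq1).
have : z \in mask m orbit by rewrite em mem_head.
move=> /mem_mask /trajectP[i lt_iD ez].
have gz : root (map_poly iota g) (iter i sigma x).
  by rewrite -ez (eqp_root gm) root_prod_XsubC mem_head.
apply: uniq_roots_dvdp; last by rewrite uniq_rootsE traject_period_uniq.
apply/allP => _ /trajectP[j lt_jD ->].
(* Going once more around the orbit keeps the exponent nonnegative when j < i. *)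
have -> : iter j sigma x = iter (j + D - i) sigma (iter i sigma x).
  rewrite -iterD subnK; last by rewrite (leq_trans (ltnW lt_iD)) ?leq_addl.
  by rewrite iterD; congr iter; apply/esym/eqP; rewrite periodP.
exact: root_sigma.
Qed.

Lemma irredp_orbit (h : {poly K}) : h \is monic -> irreducible_poly h ->
  root (map_poly iota h) x -> map_poly iota h = \prod_(z <- orbit) ('X - z%:P).
Proof.
move=> hm hi hx; have [P [Pm Pi eP]] := orbit_poly_irreducible.
rewrite -eP (irredp_monic_root hi Pi hm Pm hx) // eP root_prod_XsubC.
exact: (mem_traject_period D_gt0 periodP 0).
Qed.

Lemma irredp_orbit_size (h : {poly K}) : h \is monic -> irreducible_poly h ->
  root (map_poly iota h) x -> size h = D.+1.
Proof.
move=> hm hi hx.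
by rewrite -(size_map_poly iota) irredp_orbit // size_prod_XsubC size_traject.
Qed.

Lemma irredp_orbit_root (h : {poly K}) (y : E) : h \is monic -> irreducible_poly h ->
    root (map_poly iota h) x ->
  root (map_poly iota h) y -> exists2 k, (k < D)%N & y = iter k sigma x.
Proof.
by move=> hm hi hx; rewrite irredp_orbit // root_prod_XsubC => /trajectP.
Qed.

End Descent.

(** * Moebius transformations *)

(** There is no point at infinity: at a pole the value is 0, by the convention for inverses, so the
    denominator has to be kept nonzero along the way. *)
Definition moebius_pt (K : fieldType) (M : 'M[K]_2) (x : K) : K :=
  (M 0 0 * x + M 0 1) / (M 1 0 * x + M 1 1).

Section MoebiusPolynomials.
Variable K : fieldType.
Implicit Types (M : 'M[K]_2) (g h : {poly K}).

Lemma det2E M : \det M = M 0 0 * M 1 1 - M 0 1 * M 1 0.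
Proof.
rewrite (expand_det_row _ 0) !big_ord_recl big_ord0 addr0 /cofactor !det_mx11 !mxE /=.
rewrite expr0 expr1 mul1r mulN1r mulrN.
by congr (M _ _ * M _ _ - M _ _ * M _ _); apply: val_inj.
Qed.

Lemma root_moebius_num M h x : M 1 0 * x + M 1 1 != 0 ->
  root (moebius_num M h) x = root h (moebius_pt M x).
Proof.
set e := M 1 0 * x + M 1 1 => e0; rewrite !rootE.
suff -> : (moebius_num M h).[x] = e ^+ (size h).-1 * h.[moebius_pt M x].
  by rewrite mulf_eq0 expf_eq0 (negPf e0) andbF.
rewrite /moebius_num horner_sum [in RHS]horner_coef mulr_sumr; apply: eq_bigr => k _.
rewrite !hornerE /= -/e -!mulrA [RHS]mulrCA; congr (_ * _).
have le_k : (k <= (size h).-1)%N by rewrite -ltnS (leq_trans (ltn_ord k)) ?leqSpred.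
rewrite /moebius_pt -/e expr_div_n mulrCA; congr (_ * _).
by rewrite -{2}(subnK le_k) exprD mulfK ?expf_neq0.
Qed.

Lemma size_moebius_num M h : (size (moebius_num M h) <= size h)%N.
Proof.
have lin (a b : K) k : (size ((a *: 'X + b%:P) ^+ k)%R <= k.+1)%N.
  have : (size (a *: 'X + b%:P)%R <= 2)%N.
    rewrite (leq_trans (size_polyD _ _)) // geq_max (leq_trans (size_scale_leq _ _)) ?size_polyX //.
    by rewrite (leq_trans (size_polyC_leq1 _)).
  move=> le2; apply: leq_trans (size_poly_exp_leq _ _) _.
  by rewrite ltnS -{2}[k]mul1n leq_mul2r -subn1 leq_subLR le2 orbT.
rewrite (leq_trans (size_sum _ _ _)) //; apply/bigmax_leqP => k _.
rewrite (leq_trans (size_scale_leq _ _)) // (leq_trans (size_polyMleq _ _)) //.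
have le_k : (k <= (size h).-1)%N by rewrite -ltnS (leq_trans (ltn_ord k)) ?leqSpred.
have := leq_add (lin (M 0 0) (M 0 1) k) (lin (M 1 0) (M 1 1) ((size h).-1 - k)%N).
rewrite addSn addnS subnKC // prednK ?(leq_ltn_trans _ (ltn_ord k)) // => le.
by rewrite -subn1 leq_subLR add1n.
Qed.

Lemma moebius_num_neq0 M h : \det M != 0 -> h`_0 != 0 -> moebius_num M h != 0.
Proof.
rewrite det2E => detM h0.
have hn0 : h != 0 by apply: contraNneq h0 => ->; rewrite coef0.
have sh : (0 < size h)%N by rewrite size_poly_gt0.
(* Evaluate the numerator at the preimage of 0 if c = 0, and at the pole - d / c otherwise. *)
have [c0|c0] := eqVneq (M 1 0) 0.
  move: detM; rewrite c0 mulr0 subr0 mulf_eq0 negb_or => /andP[a0 d0].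
  apply: contraNneq h0 => num0.
  have := @root_moebius_num M h (- M 0 1 / M 0 0).
  rewrite num0 root0 c0 mul0r add0r => /(_ d0)/esym.
  by rewrite /moebius_pt mulrCA divff // mulr1 addNr mul0r rootE horner_coef0 => ->.
apply: contraNneq detM => num0.
have : (moebius_num M h).[- M 1 1 / M 1 0] = 0 by rewrite num0 horner0.
have lt_h : ((size h).-1 < size h)%N by rewrite prednK.
(* At the pole only the top term survives, the others containing a positive power of the
   denominator; it vanishes only if the determinant does. *)
rewrite /moebius_num horner_sum (bigD1 (Ordinal lt_h)) //= big1 => [|k neq_k].
  rewrite !hornerE /= subnn expr0 mulr1 => /eqP.
  rewrite mulf_eq0 lead_coef_eq0 (negPf hn0) expf_eq0 /= => /andP[_ /eqP e].
  have -> : M 0 0 * M 1 1 - M 0 1 * M 1 0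
      = - M 1 0 * (M 0 0 * - M 1 1 / M 1 0 + M 0 1) by field.
  by rewrite e mulr0.
rewrite !hornerE /=; have -> : M 1 0 * - M 1 1 / M 1 0 + M 1 1 = 0 by field.
rewrite expr0n subn_eq0 leqNgt ltn_neqAle -ltnS prednK // ltn_ord andbT.
by move: neq_k; rewrite -val_eqE /= => ->; rewrite mulr0.
Qed.

(** The numerator has degree at most that of h, so a divisor of the same degree as h is associated
    to it, and being monic fixes the scalar. Invariance is thus reduced to a divisibility. *)
Lemma moebius_eq M g h : moebius_num M h != 0 -> g \is monic -> size g = size h ->
  g %| moebius_num M h -> moebius M h = g.
Proof.
move=> num0 gm sg g_num; apply/eqP; rewrite /moebius -eqp_monic //; last first.
  by rewrite monicE lead_coefZ mulVf ?lead_coef_eq0.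
rewrite (eqp_ltrans (eqp_scale _ _)) ?invr_eq0 ?lead_coef_eq0 // eqp_sym.
by rewrite -dvdp_size_eqp // eqn_leq dvdp_leq //= sg size_moebius_num.
Qed.

Lemma moebius_eq_dvd M g h : g != 0 -> moebius M h = g -> g %| moebius_num M h.
Proof.
move=> g0 e; move: (g0); rewrite -e /moebius scaler_eq0 negb_or => /andP[c0 _].
by rewrite dvdpZl.
Qed.

End MoebiusPolynomials.

Section MoebiusMap.
Variables (K E : fieldType) (iota : {rmorphism K -> E}).

Lemma map_moebius_num (M : 'M[K]_2) h :
  map_poly iota (moebius_num M h) = moebius_num (map_mx iota M) (map_poly iota h).
Proof.
rewrite /moebius_num size_map_poly rmorph_sum; apply: eq_bigr => k _ /=.
rewrite map_polyZ rmorphM !rmorphXn !rmorphD /= !map_polyZ !map_polyX !map_polyC.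
by rewrite coef_map !mxE.
Qed.

(** A zero of the denominator is -d / c, which lies in K, unless c = d = 0 and the matrix is
    singular. *)
Lemma moebius_den_neq0 (M : 'M[K]_2) x : \det M != 0 -> (forall u, x <> iota u) ->
  (map_mx iota M) 1 0 * x + (map_mx iota M) 1 1 != 0.
Proof.
rewrite det2E !mxE => detM xK; apply/eqP => /eqP.
have [c0|c0] := eqVneq (M 1 0) 0.
  rewrite c0 rmorph0 mul0r add0r fmorph_eq0 => /eqP d0.
  by move: detM; rewrite c0 d0 !mulr0 subr0 eqxx.
rewrite addr_eq0 => /eqP e; case: (xK (- M 1 1 / M 1 0)).
by rewrite fmorph_div rmorphN -e mulrC mulKf ?fmorph_eq0.
Qed.

End MoebiusMap.

Lemma moebius_ptM (K : fieldType) (M N : 'M[K]_2) x : N 1 0 * x + N 1 1 != 0 ->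
  moebius_pt (M *m N) x = moebius_pt M (moebius_pt N x).
Proof.
rewrite /moebius_pt !mxE !big_ord_recl !big_ord0 !addr0.
have -> : lift ord0 ord0 = 1 :> 'I_2 by apply: val_inj.
set n := N 0 0 * x + _; set e := N 1 0 * x + _ => e0.
have lin a b : a * (n / e) + b = (a * n + b * e) / e by field.
rewrite !lin invf_div mulrA divfK //.
by congr (_ / _); rewrite /n /e; ring.
Qed.

Lemma moebius_pt_fix (K : fieldType) (M : 'M[K]_2) x : M 1 0 * x + M 1 1 != 0 ->
  moebius_pt M x = x ->
  root (M 1 0 *: 'X^2 + (M 1 1 - M 0 0) *: 'X - (M 0 1)%:P) x.
Proof.
move=> e0 ex; have: M 0 0 * x + M 0 1 = x * (M 1 0 * x + M 1 1) by rewrite -{2}ex /moebius_pt divfK.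
move=> en; rewrite rootE !hornerE /=; apply/eqP.
transitivity (x * (M 1 0 * x + M 1 1) - (M 0 0 * x + M 0 1)); first by ring.
by rewrite en subrr.
Qed.

(** The k-th power of the class is trivial iff A^k is central, and the centre consists of the scalar
    matrices. *)
Lemma pgl_order_dvd (F : finFieldType) (A : {'GL_2[F]}) k :
  (#[pgl_class A]%g %| k)%N =
  [&& GLval (A ^+ k) 1 0 == 0, GLval (A ^+ k) 0 1 == 0
    & GLval (A ^+ k) 0 0 == GLval (A ^+ k) 1 1].
Proof.
have ZN : A \in 'N('Z('GL_2[F]))%g.
  by rewrite (subsetP (normal_norm (center_normal 'GL_2[F]))) ?inE.
rewrite order_dvdn /pgl_class -morphX //=; move: (A ^+ k)%g (groupX k ZN) => B BN.
(* A matrix commuting with both elementary transvections is scalar. *)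
apply/eqP/and3P => [/(coset_idr BN)/centerP[_ cB]|[/eqP B10 /eqP B01 /eqP B00]].
  have com (i j : 'I_2) : i != j -> GLval B *m delta_mx i j = delta_mx i j *m GLval B.
    move=> ij; have uN : (1 + delta_mx i j : 'M[F]_2) \in unitmx.
      rewrite unitmxE unitfE det2E !mxE.
      by case: i j ij => [[|[|//]] ?] [[|[|//]] ?] //= _;
        rewrite !(mulr0n, mulr1n, addr0, mulr0, mul0r, subr0, mulr1) oner_neq0.
    have /(congr1 val) := cB (FinRing.unit 'M[F]_2 uN : {'GL_2[F]}) (in_setT _).
    by rewrite /= mulrDr mulrDl mulr1 mul1r => /addrI.
  have ord2 : lift ord0 ord0 = 1 :> 'I_2 by apply: val_inj.
  have entry := congr1 (fun N : 'M[F]_2 => (N _ _)).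
  have e01 := com 0 1 isT; have e10 := com 1 0 isT.
  move: (entry 1 1 _ _ e01) (entry 0 1 _ _ e01) (entry 0 0 _ _ e10).
  rewrite !mxE !big_ord_recl !big_ord0 !mxE ord2 /=.
  by rewrite !(mulr0n, mulr1n, addr0, add0r, mulr0, mul0r, subr0, mulr1, mul1r) => -> -> ->.
have eB : GLval B = (GLval B 0 0)%:M.
  have ord2 (i : 'I_2) : i = 0 \/ i = 1.
    by case: i => [[|[|//]] ?]; [left|right]; apply: val_inj.
  apply/matrixP => i j; rewrite !mxE.
  by case: (ord2 i) (ord2 j) => -> [] ->; rewrite ?B10 ?B01 -?B00.
apply: coset_id; apply/centerP; split; rewrite ?inE // => C _.
apply: val_inj; change (GLval B *m GLval C = GLval C *m GLval B).
by rewrite eB [LHS]mul_scalar_mx [RHS]mul_mx_scalar.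
Qed.

(** * Powers of the Frobenius map *)

Lemma coef0_irredp (K : fieldType) (h : {poly K}) :
  irreducible_poly h -> (2 < size h)%N -> h`_0 != 0.
Proof.
move=> [_ irr] sh; apply/eqP => h0; have : 'X %= h.
  by apply: irr; rewrite ?size_polyX // -['X]subr0 dvdp_XsubCl rootE horner_coef0 h0.
by move/eqp_size; rewrite size_polyX => e; rewrite -e ltnn in sh.
Qed.

Section Frobenius.
Variable F : finFieldType.

(** Closed form of the Frobenius iterate, over any extension of F, so that it acts both on
    coefficients in L and on roots in E; [frob_polyE] links it to the iterated form. *)
Definition frob (E : fieldExtType F) (k : nat) (y : E) : E := y ^+ (#|F| ^ k).

Section Instances.
Variables (E : fieldExtType F) (k : nat).

Lemma pnat_card : [pchar E].-nat (#|F| ^ k)%N.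
Proof.
have [p p_pr p_F] := finPcharP F; rewrite pnatX; apply/orP; left.
rewrite (card_pprimeChar p_F) pnatX pnatE //.
by rewrite (pchar_lalg E) p_F.
Qed.

Fact frob_zmod : zmod_morphism (@frob E k).
Proof. by move=> y z; rewrite /frob exprDn_pchar ?exprNn_pchar // pnat_card. Qed.

Fact frob_monoid : monoid_morphism (@frob E k).
Proof. by split=> [|y z]; rewrite /frob ?expr1n ?exprMn. Qed.

Fact frob_scalable : scalable (@frob E k).
Proof.
move=> a y; rewrite /frob exprZn; congr (_ *: _).
by elim: k => [|j IH]; rewrite ?expr1 // expnS exprM expf_card.
Qed.

HB.instance Definition _ := GRing.isZmodMorphism.Build E E (@frob E k) frob_zmod.
HB.instance Definition _ := GRing.isMonoidMorphism.Build E E (@frob E k) frob_monoid.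
HB.instance Definition _ := GRing.isScalable.Build F E E *:%R (@frob E k) frob_scalable.

End Instances.

Lemma iter_frob (E : fieldExtType F) i k (y : E) : iter k (frob i) y = frob (i * k) y.
Proof.
elim: k => [|k IH]; first by rewrite muln0 /frob expn0 expr1.
by rewrite iterS IH mulnS addnC /frob -exprM -expnD.
Qed.

Lemma frobD (E : fieldExtType F) i k (y : E) : frob (i + k) y = frob i (frob k y).
Proof. by rewrite /frob -exprM -expnD addnC. Qed.

Lemma rmorph_frob (L E : fieldExtType F) (iota : {rmorphism L -> E}) k y :
  iota (frob k y) = frob k (iota y).
Proof. exact: rmorphXn. Qed.

Lemma frob_base (E : fieldExtType F) k a : frob k a%:A = a%:A :> E.
Proof. by rewrite linearZ rmorph1. Qed.

Lemma frob_polyE (L : fieldExtType F) i (f : {poly L}) : frob_poly i f = map_poly (frob i) f.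
Proof.
apply: eq_map_poly => y; elim: i => [|i IH]; first by rewrite /frob expr1.
by rewrite iterS IH /frob -exprM -expnSr.
Qed.

Lemma frob_subfield (E : fieldExtType F) (K : {subfield E}) y :
  (y \in K) = (frob (\dim K) y == y).
Proof. exact: Fermat's_little_theorem. Qed.

Lemma frob_dim (E : fieldExtType F) (y : E) : frob (\dim {:E}) y = y.
Proof. by apply/eqP; rewrite -(frob_subfield {:E}%AS) memvf. Qed.

Lemma frob_fix_base (E : fieldExtType F) (y : E) :
  frob 1 y = y <-> exists a, y = in_alg E a.
Proof.
have -> : frob 1 y = y <-> y \in 1%VS.
  by rewrite (frob_subfield 1%AS) dimv1; split=> /eqP.
by split=> [/vlineP[a ->]|[a ->]]; [exists a | apply/vlineP; exists a].
Qed.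

(** The q^(dim K) elements of K are all roots of X^(q^u) - X. *)
Lemma dim_frob_fixed (L : fieldExtType F) (K : {subfield L}) u : (0 < u)%N ->
  {in K, forall y, frob u y = y} -> (\dim K <= u)%N.
Proof.
move=> u0 fixK; rewrite -(leq_exp2l _ _ (finNzRing_gt1 F)).
pose LF := finvect_type L; pose KF : {vspace LF} := K.
have cK : #|KF| = (#|F| ^ \dim K)%N by apply: card_vspace.
have q1 : (1 < #|F| ^ u)%N by rewrite -(expn0 #|F|) ltn_exp2l ?finNzRing_gt1.
have sP : size ('X^(#|F| ^ u) - 'X : {poly LF}) = (#|F| ^ u).+1.
  by rewrite size_polyDl size_polyXn // size_polyN size_polyX ltnS.
have := @max_poly_roots LF ('X^(#|F| ^ u) - 'X) (enum KF).
rewrite sP -cardE cK; apply; first by rewrite -size_poly_gt0 sP.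
  apply/allP => y; rewrite mem_enum => /fixK yK.
  by rewrite rootE !hornerE /= subr_eq0; apply/eqP.
exact: enum_uniq.
Qed.

Lemma frob_fixed_subfield (L : fieldExtType F) u :
  exists K : {subfield L}, forall y, (y \in K) = (frob u y == y).
Proof.
exists (fixedSpace_aspace (linfun_ahom (@frob L u))) => y.
by apply/fixedSpaceP/eqP; rewrite lfunE.
Qed.

(** Adjoin a root to L, then restrict scalars to F. The copy of L has dimension n over F, so
    Fermat's little theorem makes it the fixed field of the n-th Frobenius power. *)
Lemma root_extension (L : fieldExtType F) (f : {poly L}) : irreducible_poly f ->
  exists (E : fieldExtType F) (iota : {rmorphism L -> E}) (x : E),
    [/\ forall a, iota (in_alg L a) = in_alg E a,
        forall y, frob (\dim {:L}) y = y <-> exists z, y = iota z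
      & root (map_poly iota f) x].
Proof.
move=> f_irr; have [E1 _ [x fx _]] := irredp_FAdjoin f_irr.
pose E : fieldExtType F := baseFieldType E1.
pose iota : {rmorphism L -> E} := in_alg E1.
exists E, iota, x; split=> // y.
have e : ((y : E1) \in 1%VS) = (frob (\dim {:L}) y == y).
  have := frob_subfield (baseAspace (1%AS : {subfield E1})) y.
  by rewrite dim_baseVspace dimv1 mul1n mem_baseVspace.
split=> [/eqP ey|[z ->]].
  by move: e; rewrite ey => /vlineP[z ->]; exists z.
by rewrite -(rmorph_frob iota) frob_dim.
Qed.

End Frobenius.

(** * The orbit of a root of f *)

Section RootOrbit.
Variables (F : finFieldType) (L E : fieldExtType F) (iota : {rmorphism L -> E}).
Hypothesis iota_base : forall a, iota (in_alg L a) = in_alg E a.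
Let n := \dim {:L}.
Hypothesis fixL : forall y : E, frob n y = y <-> exists z, y = iota z.

Variables (f : {poly L}) (x : E) (D : nat).
Hypothesis f_monic : f \is monic.
Hypothesis f_irr : irreducible_poly f.
Hypothesis f_gt2 : (3 < size f)%N.
Hypothesis fx : root (map_poly iota f) x.
Hypothesis D_gt0 : (0 < D)%N.
Hypothesis period : forall k, (frob k x == x) = (D %| k)%N.

Lemma frob_eq_mod i j : (frob i x == frob j x) = (i == j %[mod D])%N.
Proof.
have e k : iter k (frob 1) x = frob k x by rewrite iter_frob mul1n.
have inj1 : injective (@frob F E 1) by apply: (@fmorph_inj E E (@frob F E 1)).
by rewrite -!e; apply: (iter_period_mod inj1) => k; rewrite e.
Qed.

Lemma period1 k : (iter k (frob 1) x == x) = (D %| k)%N.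
Proof. by rewrite iter_frob mul1n. Qed.

Lemma periodn k : (iter k (frob n) x == x) = (D %/ gcdn D n %| k)%N.
Proof. by rewrite iter_frob period dvdn_mul_gcd. Qed.

Let Dn_gt0 : (0 < D %/ gcdn D n)%N.
Proof. by rewrite divn_gt0 ?gcdn_gt0 ?D_gt0 // dvdn_leq ?dvdn_gcdl. Qed.

Lemma size_f : size f = (D %/ gcdn D n).+1.
Proof. exact: (irredp_orbit_size fixL Dn_gt0 periodn). Qed.

Lemma root_notin u : x <> iota u.
Proof.
move=> ex; have : (D %/ gcdn D n %| 1)%N.
  by rewrite -periodn /=; apply/eqP/fixL; exists u.
by rewrite dvdn1 => /eqP e; move: f_gt2; rewrite size_f e.
Qed.

Lemma root_notin_base a : x <> in_alg E a.
Proof. by rewrite -iota_base; apply: root_notin. Qed.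

(** A nonzero p would be a multiple of f, whose degree exceeds 2. *)
Lemma low_degree_root (p : {poly L}) : (size p <= 3)%N -> root (map_poly iota p) x -> p = 0.
Proof.
move=> sp px; apply/eqP; apply: contraTT sp => p0; rewrite -ltnNge.
by apply: leq_trans f_gt2 (dvdp_leq p0 (irredp_dvd_root f_irr fx px)).
Qed.

Let map_iota_base (p : {poly F}) :
  map_poly iota (map_poly (in_alg L) p) = map_poly (in_alg E) p.
Proof. by rewrite -map_poly_comp; apply: eq_map_poly => a; apply: iota_base. Qed.

Let map_mx_base (M : 'M[F]_2) :
  map_mx iota (map_mx (in_alg L) M) = map_mx (in_alg E) M.
Proof. by apply/matrixP => i j; rewrite !mxE iota_base. Qed.

Lemma map_frob_iota k (p : {poly L}) :
  map_poly iota (map_poly (frob k) p) = map_poly (frob k) (map_poly iota p).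
Proof. by rewrite -!map_poly_comp; apply: eq_map_poly => y; apply: rmorph_frob. Qed.

Lemma root_map_frob k (p : {poly L}) y : root (map_poly iota p) y ->
  root (map_poly iota (map_poly (frob k) p)) (frob k y).
Proof. by rewrite map_frob_iota mapf_root. Qed.

Lemma f_conj k : root (map_poly iota f) (frob (n * k) x).
Proof. by rewrite -iter_frob; apply: root_sigma. Qed.

Lemma f_rootP y : root (map_poly iota f) y -> exists k, y = frob (n * k) x.
Proof.
case/(irredp_orbit_root fixL Dn_gt0 periodn f_monic f_irr fx) => k _ ->.
by exists k; rewrite iter_frob.
Qed.

Variable A : {'GL_2[F]}.
Let AE := map_mx (in_alg E) (GLval A).

Lemma den_neq0 (B : {'GL_2[F]}) :
  map_mx (in_alg E) (GLval B) 1 0 * x + map_mx (in_alg E) (GLval B) 1 1 != 0.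
Proof. exact: (moebius_den_neq0 (GL_det B) root_notin_base). Qed.

(** The numerator vanishes at x iff sigma_i(f) vanishes at A x, and the roots of sigma_i(f) are the
    images under phi^i of the conjugates phi^(nk) x. Conversely, one common root makes the
    irreducible f divide the numerator. *)
Lemma semi_invariantP i :
  semi_invariant A i f <-> exists k, moebius_pt AE x = frob (i + n * k) x.
Proof.
have fi0 : map_poly iota (frob_poly i f) = map_poly (frob i) (map_poly iota f).
  by rewrite frob_polyE map_frob_iota.
have num_root : root (map_poly iota (moebius_num (map_mx (in_alg L) (GLval A)) (frob_poly i f))) x
    = root (map_poly (frob i) (map_poly iota f)) (moebius_pt AE x).
  by rewrite map_moebius_num map_mx_base root_moebius_num ?den_neq0 // fi0.
split=> [/moebius_eq_dvd|[k e]].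
  move/(_ (monic_neq0 f_monic)) => dv.
  have : root (map_poly iota (moebius_num (map_mx (in_alg L) (GLval A)) (frob_poly i f))) x.
    by move: dv; rewrite -(dvdp_map iota) => /dvdpP[g ->]; rewrite rootM fx orbT.
  rewrite num_root (irredp_orbit fixL Dn_gt0 periodn f_monic f_irr fx) rmorph_prod /=.
  rewrite (eq_bigr (fun z => 'X - (frob i z)%:P)) => [|z _]; last first.
    by rewrite rmorphB /= map_polyX map_polyC.
  rewrite -(big_map (frob i) xpredT (fun z => 'X - z%:P)) root_prod_XsubC.
  by case/mapP => z /trajectP[k _ ->] ->; exists k; rewrite iter_frob frobD.
apply: moebius_eq.
- apply: moebius_num_neq0; first by rewrite det_map_mx fmorph_eq0; apply: (GL_det A).
  by rewrite frob_polyE coef_map fmorph_eq0 coef0_irredp // ltnW.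
- exact: f_monic.
- by rewrite frob_polyE size_map_poly.
apply: (irredp_dvd_root f_irr fx); rewrite num_root e frobD mapf_root.
exact: f_conj.
Qed.

(** The entries of A lie in F, so the action of A commutes with Frobenius. *)
Lemma moebius_pt_pow j k : moebius_pt AE x = frob j x ->
  moebius_pt (map_mx (in_alg E) (GLval (A ^+ k))) x = frob (j * k) x.
Proof.
move=> e; elim: k => [|k IH].
  have -> : GLval (A ^+ 0)%g = 1%:M by [].
  rewrite map_mx1 muln0 /frob expr1 /moebius_pt !mxE /=.
  by rewrite mulr1n mulr0n mul1r mul0r addr0 add0r divr1.
rewrite expgS; have -> : GLval (A * A ^+ k)%g = GLval A *m GLval (A ^+ k)%g by [].
rewrite map_mxM moebius_ptM ?den_neq0 // IH mulnS addnC frobD -e.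
rewrite /moebius_pt fmorph_div !rmorphD !rmorphM.
by rewrite !mxE /= !frob_base.
Qed.

(** A fixed point of (a b; c d) is a root of cX^2 + (d - a)X - b. For x this polynomial must be
    zero, which says that the matrix is scalar. *)
Lemma moebius_pt_fixP k :
  (moebius_pt (map_mx (in_alg E) (GLval (A ^+ k))) x == x) = (#[pgl_class A]%g %| k)%N.
Proof.
rewrite pgl_order_dvd; set B := (A ^+ k)%g.
apply/eqP/and3P => [/(moebius_pt_fix (den_neq0 B)) Bx|[/eqP B10 /eqP B01 /eqP B00]].
  pose M : 'M[F]_2 := GLval B.
  pose P := M 1 0 *: 'X^2 + (M 1 1 - M 0 0) *: 'X - (M 0 1)%:P.
  have P0 : P = 0.
    apply/eqP; rewrite -(map_poly_eq0 (in_alg L)); apply/eqP/low_degree_root.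
      rewrite size_map_poly /P.
      rewrite (leq_trans (size_polyD _ _)) // geq_max size_polyN.
      rewrite (leq_trans (size_polyC_leq1 _)) // andbT.
      rewrite (leq_trans (size_polyD _ _)) // geq_max !(leq_trans (size_scale_leq _ _)) //.
        by rewrite size_polyX.
      by rewrite size_polyXn.
    rewrite map_iota_base /P rmorphB rmorphD /= !map_polyZ map_polyXn map_polyX map_polyC.
    by move: Bx; rewrite !mxE rmorphB.
  have coefP i := congr1 (fun p : {poly F} => p`_i) P0.
  move: (coefP 2) (coefP 1%N) (coefP 0%N); rewrite !coefE /=.
  rewrite !(mulr0, mulr1, addr0, add0r, subr0).
  by move=> /eqP-> /eqP; rewrite subr_eq0 eq_sym => -> /eqP; rewrite oppr_eq0 => ->.
have := den_neq0 B; rewrite /moebius_pt !mxE B10 B01 B00 !rmorph0 !mul0r !add0r addr0.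
by move=> d0; rewrite mulrC mulKf.
Qed.

(** Both sides divide exactly the k with A^k x = phi^(jk) x = x. *)
Lemma order_frob j : moebius_pt AE x = frob j x -> (D %/ gcdn D j = #[pgl_class A]%g)%N.
Proof.
move=> e; apply/eqP; rewrite eqn_dvd.
rewrite -dvdn_mul_gcd // -period -(moebius_pt_pow _ e) // moebius_pt_fixP dvdnn /=.
by rewrite -moebius_pt_fixP (moebius_pt_pow _ e) // period dvdn_mul_gcd // dvdnn.
Qed.

(** Both sides say that phi^u x is a conjugate of x over L, that is, that u is a multiple of n
    modulo D. *)
Lemma frob_invariantP u : map_poly (frob u) f = f <-> (gcdn D n %| u)%N.
Proof.
split=> [e|].
  have : root (map_poly iota f) (frob u x) by rewrite -e root_map_frob.
  case/f_rootP => k /eqP; rewrite frob_eq_mod => /eqP euk.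
  rewrite /dvdn -(modn_dvdm u (dvdn_gcdl D n)) euk modn_dvdm ?dvdn_gcdl //.
  by rewrite -/(dvdn _ _) dvdn_mulr ?dvdn_gcdr.
case/dvdnP => c eu.
(* Bezout gives gcd(D, n) = -an modulo D; below, the factor D - 1 stands for -1. *)
have [a _ Da] := Bezoutl n D_gt0.
have root_u : root (map_poly iota f) (frob u x).
  suff /eqP -> : frob u x == frob (n * (a * (D.-1) * c)) x by apply: f_conj.
  rewrite frob_eq_mod eu -(eqn_modDr (n * (a * c))) -mulnDr.
  have -> : (a * D.-1 * c + a * c = a * c * D)%N by rewrite mulnAC addnC -mulnS prednK.
  have -> : (c * gcdn D n + n * (a * c) = c * (gcdn D n + a * n))%N.
    by rewrite mulnDr; congr addn; rewrite mulnC -mulnA mulnCA.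
  by rewrite mulnA modnMl; apply: dvdn_mull.
have f_dvd := irredp_dvd_root f_irr root_u (root_map_frob u fx).
apply/esym/eqP; rewrite -eqp_monic //; last by rewrite map_monic.
by rewrite -dvdp_size_eqp // size_map_poly.
Qed.

Lemma least_defined_gcd : least_defined_over (gcdn D n) f.
Proof.
have g0 : (0 < gcdn D n)%N by rewrite gcdn_gt0 D_gt0.
have least u : defined_over u f -> (gcdn D n %| u)%N.
  case=> K <- /polyOverP fK; apply/frob_invariantP/polyP => i.
  by rewrite coef_map; apply/eqP; rewrite /= -(frob_subfield K).
split=> // [|u u0 /least/dvdn_leq-> //].
have [K memK] := frob_fixed_subfield L (gcdn D n).
have /polyP ef := (frob_invariantP (gcdn D n)).2 (dvdnn _).
have fK : f \is a polyOver K.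
  by apply/polyOverP => i; rewrite memK -coef_map ef.
(* Counting bounds the dimension of the fixed field K by the gcd; as f is defined over K, the gcd
   also divides this dimension. *)
exists K => //; apply/eqP; rewrite eqn_leq dim_frob_fixed //=; last first.
  by move=> y; rewrite memK => /eqP.
by rewrite dvdn_leq ?adim_gt0 //; apply: least; exists K.
Qed.

End RootOrbit.

(** * The equivalence *)

Lemma frob_period_exists (F : finFieldType) (E : fieldExtType F) (x : E) :
  exists2 D, (0 < D)%N & forall k, (frob k x == x) = (D %| k)%N.
Proof.
have [|D D0 per] := @period_exists _ (frob 1) x (\dim {:E}) (adim_gt0 _).
  by rewrite iter_frob mul1n frob_dim.
by exists D => // k; rewrite -per iter_frob mul1n.
Qed.

(** Write D = dg with g = gcd(D, j). Since g divides j it is coprime to n, so gcd(D, n) = gcd(d, n),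
    and comparing the two expressions of the degree gives g = s. *)
Lemma period_eq_order_mul (D d j n s : nat) : (0 < D)%N ->
    (D %/ gcdn D j = d)%N -> coprime j n ->
    (D %/ gcdn D n = d %/ gcdn d n * s)%N ->
  D = (d * s)%N /\ gcdn D n = gcdn d n.
Proof.
move=> D0 ed j_n es; pose g := gcdn D j.
have eD : D = (d * g)%N by rewrite -ed divnK ?dvdn_gcdl.
have g_n : coprime n g by rewrite coprime_sym; apply: coprime_dvdl (dvdn_gcdr D j) j_n.
have egn : gcdn D n = gcdn d n by rewrite eD gcdnC Gauss_gcdl // gcdnC.
have d0 : (0 < d)%N by move: D0; rewrite eD muln_gt0 => /andP[].
have q0 : (0 < d %/ gcdn d n)%N by rewrite divn_gt0 ?gcdn_gt0 ?d0 // dvdn_leq ?dvdn_gcdl.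
split=> //; rewrite {1}eD; congr muln; apply/eqP; rewrite -(eqn_pmul2l q0) -es egn.
by rewrite {1}eD divn_mulAC ?dvdn_gcdl.
Qed.

(** Here k = ls with l coprime to d. Shifting l by a multiple of d makes it coprime to n and changes
    k by a multiple of D = ds. *)
Lemma coprime_frob_exponent (D d k n s : nat) : (0 < n)%N -> (0 < D)%N -> D = (d * s)%N ->
    (D %/ gcdn D k = d)%N -> coprime s n ->
  exists2 j, (0 < j)%N & coprime j n /\ (j = k %[mod D])%N.
Proof.
move=> n0 D0 eD ed s_n.
have [d0 s0] : (0 < d)%N /\ (0 < s)%N by apply/andP; rewrite -muln_gt0 -eD.
have eg : gcdn D k = s.
  apply/eqP; rewrite -(eqn_pmul2l d0) -eD -ed divnK ?dvdn_gcdl //.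
have /dvdnP[l ek] : (s %| k)%N by rewrite -eg dvdn_gcdr.
have l_d : coprime l d.
  by rewrite /coprime -(eqn_pmul2r s0) muln_gcdl -ek gcdnC -eD eg mul1n.
have [c l_n] := coprime_shift d0 n0 l_d.
(* The extra n keeps the exponent positive without affecting coprimality to n. *)
exists ((l + d * (c + n)) * s)%N.
  by rewrite muln_gt0 s0 addn_gt0 muln_gt0 d0 addn_gt0 n0 !orbT.
split; last first.
  by rewrite mulnDl -ek mulnAC -eD addnC mulnC modnMDl.
rewrite coprimeMl s_n andbT mulnDr addnA.
by rewrite /coprime addnC gcdnC gcdnMDl gcdnC.
Qed.

Section Main.
Variables (F : finFieldType) (L : fieldExtType F) (A : {'GL_2[F]}) (f : {poly L}).
Let n := \dim {:L}.
Let d := #[pgl_class A]%g.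
Variable s : nat.
Hypothesis s_n : gcdn s n = 1%N.
Hypothesis f_monic : f \is monic.
Hypothesis f_irr : irreducible_poly f.
Hypothesis f_deg : (size f).-1 = (d %/ gcdn d n * s)%N.
Hypothesis f_deg_gt2 : (2 < d %/ gcdn d n * s)%N.

Let f_gt2 : (3 < size f)%N.
Proof. by move: f_deg_gt2; rewrite -f_deg; case: (size f). Qed.

Lemma coprime_semi_invariant :
  (exists i : nat, [/\ (1 <= i <= n)%N, gcdn i n = 1%N & semi_invariant A i f]) ->
  least_defined_over (gcdn d n) f /\
  exists G : {poly F},
         [/\ G \is monic, irreducible_poly G, (size G).-1 = (d * s)%N,
             moebius (GLval A) G = G & f %| map_poly (in_alg L) G].
Proof.
have [E [iota [x [base fixL fx]]]] := root_extension f_irr.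
have [D D0 per] := frob_period_exists x.
case=> i [_ i_n /(semi_invariantP base fixL f_monic f_irr f_gt2 fx D0 per)[k ek]].
have ed := order_frob base fixL f_monic f_irr f_gt2 fx D0 per ek.
have sf := size_f fixL f_monic f_irr fx D0 per.
have [eD eg] : D = (d * s)%N /\ gcdn D n = gcdn d n.
  apply: period_eq_order_mul ed _ _ => //; last by rewrite -f_deg sf.
  by rewrite /coprime addnC mulnC gcdnC gcdnMDl gcdnC i_n.
split; first by rewrite -eg; apply: (least_defined_gcd fixL f_monic f_irr fx D0 per).
have per1 := period1 per.
have [G [Gm Girr eG]] := orbit_poly_irreducible (@frob_fix_base _ _) D0 per1.
have Gorb l : root (map_poly (in_alg E) G) (frob l x).
  by rewrite eG root_prod_XsubC -[l]mul1n -iter_frob (mem_traject_period D0 per1).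
have Gx : root (map_poly (in_alg E) G) x by rewrite -[x]expr1; apply: (Gorb 0).
have sG := irredp_orbit_size (@frob_fix_base _ _) D0 per1 Gm Girr Gx.
have sG2 : (2 < size G)%N.
  rewrite sG ltnS; apply: leq_trans (leq_div D (gcdn D n)).
  by move: f_gt2; rewrite sf => /ltnW.
exists G; split=> //; first by rewrite sG eD.
  (* A x is a Frobenius conjugate of x, hence again a root of G. *)
  apply: moebius_eq => //.
    by apply: moebius_num_neq0; [apply: (GL_det A) | apply: coef0_irredp].
  apply: (irredp_dvd_root Girr Gx).
  rewrite map_moebius_num root_moebius_num; first by rewrite ek; apply: Gorb.
  exact: (den_neq0 base fixL f_monic f_irr f_gt2 fx D0 per).
apply: (irredp_dvd_root f_irr fx); rewrite -map_poly_comp.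
by rewrite (eq_map_poly base).
Qed.

Lemma invariant_factor (G : {poly F}) : G \is monic -> irreducible_poly G ->
    (size G).-1 = (d * s)%N -> moebius (GLval A) G = G -> f %| map_poly (in_alg L) G ->
  exists i : nat, [/\ (1 <= i <= n)%N, gcdn i n = 1%N & semi_invariant A i f].
Proof.
move=> Gm Girr dG AG fG.
have [E [iota [x [base fixL fx]]]] := root_extension f_irr.
have [D D0 per] := frob_period_exists x.
have per1 := period1 per.
have Gx : root (map_poly (in_alg E) G) x.
  move: fG; rewrite -(dvdp_map iota) -map_poly_comp (eq_map_poly base).
  by case/dvdpP => g ->; rewrite rootM fx orbT.
have sG := irredp_orbit_size (@frob_fix_base _ _) D0 per1 Gm Girr Gx.
have eD : D = (d * s)%N by rewrite -dG sG.
have : root (map_poly (in_alg E) G) (moebius_pt (map_mx (in_alg E) (GLval A)) x).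
  rewrite -root_moebius_num; last exact: (den_neq0 base fixL f_monic f_irr f_gt2 fx D0 per).
  rewrite -map_moebius_num.
  have := moebius_eq_dvd (monic_neq0 Gm) AG.
  by rewrite -(dvdp_map (in_alg E)) => /dvdpP[g ->]; rewrite rootM Gx orbT.
case/(irredp_orbit_root (@frob_fix_base _ _) D0 per1 Gm Girr Gx) => k _.
rewrite iter_frob mul1n => ek.
have ed := order_frob base fixL f_monic f_irr f_gt2 fx D0 per ek.
have n0 : (0 < n)%N := adim_gt0 _.
have [j j0 [j_n /eqP jk]] := coprime_frob_exponent n0 D0 eD ed (introT eqP s_n).
(* Division of j - 1 rather than j puts the remainder i in 1..n instead of 0..n-1. *)
have ej : j = ((j.-1 %% n).+1 + n * (j.-1 %/ n))%N.
  by rewrite addSn mulnC addnC -divn_eq prednK.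
exists (j.-1 %% n).+1; split; first by rewrite /= ltn_mod.
  by move: j_n; rewrite /coprime {1}ej addnC mulnC gcdnC gcdnMDl gcdnC => /eqP.
apply/(semi_invariantP base fixL f_monic f_irr f_gt2 fx D0 per).
exists (j.-1 %/ n)%N; rewrite -ej ek; apply/eqP.
by rewrite (frob_eq_mod per) eq_sym.
Qed.

End Main.

Theorem theorem4p1 (q n d s : nat) (F : finFieldType) (L : fieldExtType F)
    (A : {'GL_2[F]}) (f : {poly L})
    (hq : #|F| = q) (hn : \dim {:L} = n) (n_gt0 : (0 < n)%N)
    (hd : #[pgl_class A]%g = d)
    (s_gt0 : (0 < s)%N) (s_n : gcdn s n = 1%N)
    (f_monic : f \is monic) (f_irr : irreducible_poly f)
    (f_deg : (size f).-1 = (d %/ gcdn d n * s)%N)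
    (f_deg_gt2 : (2 < d %/ gcdn d n * s)%N) :
  [<-> exists i : nat,
         [/\ (1 <= i <= n)%N, gcdn i n = 1%N & semi_invariant A i f];
       (exists i : nat,
         [/\ (1 <= i <= n)%N, gcdn i n = 1%N & semi_invariant A i f])
       /\ least_defined_over (gcdn d n) f;
       exists G : {poly F},
         [/\ G \is monic, irreducible_poly G, (size G).-1 = (d * s)%N,
             moebius (GLval A) G = G & f %| map_poly (in_alg L) G]].
Proof.
subst n d; have fwd := coprime_semi_invariant f_monic f_irr f_deg f_deg_gt2.
tfae.
- by move=> inv; split=> //; case: (fwd inv).
- by case=> /fwd[].
- case=> G [Gm Girr dG AG fG].
  exact: (invariant_factor s_n f_monic f_irr f_deg f_deg_gt2 Gm Girr dG AG fG).
Qed.
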